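(* Let $\mathcal{G}=(\mathcal{V},\mathcal{E})$ be a finite directed multigraph with unit-capacity edges, with a source $s$ multicasting $m$ symbols of $\mathbb{F}_q$ per unit time to $d$ sinks $r_1,\dots,r_d$, each having max-flow at least $m$ from $s$, and run the ARCNC algorithm over $\mathbb{F}_q$. Let $T_N=\max\{T_{r_1},\dots,T_{r_d}\}$ be the time it takes for all sinks to decode. For any given $0<\varepsilon<1$ there exists $T_0>0$ such that for every $t\ge T_0$, ARCNC solves the multicast problem by time $t$ with probability at least $1-\varepsilon$, i.e. $$P(T_N>t)<\varepsilon .$$
   Context: Network and code. For a node $v$, $In(v)$ and $Out(v)$ are the sets of incoming and outgoing edges; $In(s)=\emptyset$. An adjacent pair is an ordered pair $(e',e)$ of edges with $e'\in In(v)$, $e\in Out(v)$ for some node $v$. Let $q$ be a prime power and let $z$ denote a unit-time delay. Each adjacent pair $(e',e)$ carries a local encoding kernel $k_{e',e}(z)=\sum_{i\ge 0}k_{e',e,i}z^i$ with $k_{e',e,i}\in\mathbb{F}_q$. Each edge $e$ carries a global encoding kernel $f_e(z)$, a column vector of length $m$. For $e\in Out(s)$, $f_e(z)=\sum_{i\ge0} f_{e,i}z^i$ with $f_{e,i}\in\mathbb{F}_q^m$ chosen by the source. For $e\in Out(v)$, $v\ne s$, $f_e(z)=\sum_{e'\in In(v)}k_{e',e}(z)f_{e'}(z)$. The data on $e$ is $y_e(z)=x(z)f_e(z)$, where $x(z)=\sum_{t\ge0}x_tz^t$ is the source message series ($x_t\in\mathbb{F}_q^m$ row vectors). The global encoding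 kernel matrix at node $v$ is the $m\times|In(v)|$ matrix $F_v(z)=(f_e(z))_{e\in In(v)}$. ARCNC algorithm (Adaptive Random Convolutional Network Coding). All kernels are initially $0$. At each time $t=0,1,2,\dots$ the coefficient $k_{e',e,t}$ of each adjacent pair (and likewise each entry of $f_{e,t}$ for $e\in Out(s)$) is chosen uniformly at random from $\mathbb{F}_q$, independently of all other coefficients; thus at time $t$ the kernels are polynomials in $z$ of degree at most $t$. In a cyclic network, the time-$0$ coefficients $k_{e',e,0}$ of certain adjacent pairs are instead set to $0$ so that every directed cycle contains at least one adjacent pair with $k_{e',e,0}=0$ (this makes the global kernels uniquely determined as power series in $z$); for $t\geq1$ the algorithm proceeds as in the acyclic case. A sink $r$ satisfies the decodability condition at time $t$ if $F_r(z)$, computed from the kernels at time $t$, has full rank $m$ (over the field of fractions in $z$); it then sends an acknowledgment (ACK) to its parents. A node that has received ACKs from all its children at time $t_0$ sends an ACK to its parents and sets $k_{e',e,t}=0$ for all its adjacent pairs and all $t>t_0$. ACKs are instantaneous. The first decoding time $T_r$ of sink $r$ is the earliest time at which $r$ satisfies the decodability condition. The multicast problem is solved by time $t$ if all sinks can decode by time $t$, i.e. $T_N\le t$.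
   Formalization: A sink that has outgoing edges sends its ACK only once it has decoded and all its children have sent ACKs (with an ACK on decoding alone the claim can fail when one sink feeds another); directed cycles are read as closed walks with distinct edges. *)

(* Defs.v *)
From HB Require Import structures.
From mathcomp Require Import all_boot all_order all_algebra finmap.
From mathcomp Require Import all_classical all_reals all_analysis.

Set Implicit Arguments.
Unset Strict Implicit.
Unset Printing Implicit Defensive.

Import Order.TTheory GRing.Theory Num.Theory.

Local Open Scope ring_scope.

(** * Networks *)

Record network := Network {
  node : finType;
  edge : finType;
  etail : edge -> node;
  ehead : edge -> node;
  source : node;
  source_no_in : forall e, ehead e != source }.

Arguments etail {n} _.
Arguments ehead {n} _.
Arguments source {n}.

Section Network.
Variable N : network.
Implicit Types (v : node N) (e : edge N).

Definition In v : {set edge N} := [set e | ehead e == v]%SET.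
Definition Out v : {set edge N} := [set e | etail e == v]%SET.

Definition adjacent : rel (edge N) := fun e' e => ehead e' == etail e.

(** Cycles may revisit nodes, but not edges: hitting only the node-simple cycles
    would not make the global kernels well defined (think of two loops sharing
    a node). *)
Definition directed_cycle (c : seq (edge N)) : Prop :=
  c <> [::] /\ ucycle adjacent c.

(** [Z] is the set of adjacent pairs whose time-0 coefficient is forced to 0. *)
Definition delay_set (Z : {set edge N * edge N}) : Prop :=
  [/\ forall e' e, (e', e) \in Z -> adjacent e' e,
      forall c, directed_cycle c -> exists2 e, e \in c & (e, next c e) \in Z
    & ~ (exists c, directed_cycle c) -> Z = finset.set0].

Section MaxFlow.
Variable R : realType.

Definition is_flow v (g : edge N -> R) : Prop :=
  (forall e, 0 <= g e <= 1) /\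
  (forall u, u != source -> u != v ->
     \sum_(e in In u) g e = \sum_(e in Out u) g e).

(** No edge enters the source, so the outflow is the net outflow. *)
Definition flow_value (g : edge N -> R) : R := \sum_(e in Out source) g e.

Definition max_flow v : R :=
  sup [set flow_value g | g in [set g | is_flow v g]]%classic.

End MaxFlow.
End Network.

(** * Encoding kernels *)

Section Kernels.
Variables (N : network) (F : finFieldType) (m : nat).
Variables (k : edge N -> edge N -> {poly F}).
Variables (fs : edge N -> 'cV[{poly F}]_m).

Local Notation Fz := {fraction {poly F}}.

Definition global_kernels (f : edge N -> 'cV[Fz]_m) : Prop :=
  forall e, f e =
    if etail e == source then map_mx (@tofrac {poly F}) (fs e)
    else \sum_(e' in In (etail e)) tofrac (k e' e) *: f e'.

Definition kernel_mx (f : edge N -> 'cV[Fz]_m) (v : node N) :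
    'M[Fz]_(m, #|In v|) :=
  \matrix_(i, j) f (enum_val j) i ord0.

(** The global kernels are unique as soon as every directed cycle contains a
    pair whose local kernel is divisible by z: the linear system defining them
    then has determinant 1 modulo z. *)
Definition decodable (v : node N) : bool :=
  `[< exists2 f, global_kernels f & \rank (kernel_mx f v) = m >].

End Kernels.

(** * The ARCNC algorithm *)

Section Arcnc.
Variables (N : network) (F : finFieldType) (m n : nat).
Variables (r : 'I_n -> node N) (Z : {set edge N * edge N}).

(** [(inl (e', e), t)] indexes k_{e',e,t}; [(inr (e, i), t)] indexes the i-th
    entry of f_{e,t}. *)
Definition coef_index : Type :=
  ((edge N * edge N) + (edge N * 'I_m)) * nat.

Definition drawn (i : coef_index) : bool :=
  match i with
  | (inl p, t) => adjacent p.1 p.2 && ((t == 0%N) ==> (p \notin Z))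
  | (inr (e, _), _) => etail e == source
  end.

Definition is_sink (v : node N) : bool := [exists i, r i == v].

(** ACKs propagate instantaneously, so the nodes that have sent one form a least
    fixed point.  [D] is the set of sinks that have already satisfied the
    decodability condition.  A sink that is also a relay sends its ACK once it
    has decoded and has heard from all its children. *)
Definition acked (D : {set node N}) : {set node N} :=
  fixset (fun A : {set node N} =>
    [set v | (is_sink v ==> (v \in D)) &&
             [forall e in Out v, ehead e \in A]]%SET).

Definition stopped (D : {set node N}) : {set node N} :=
  [set v | [forall e in Out v, ehead e \in acked D]]%SET.

Record state := State {
  lker : edge N -> edge N -> {poly F};
  sker : edge N -> 'cV[{poly F}]_m;
  decoded : {set node N} }.

(** [x] is the sequence of random draws, [S] the set of nodes that have stopped
    before time [t]. *)
Definition step (x : coef_index -> F) (S : {set node N}) (t : nat) (st : state)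
    : state :=
  let k e' e := lker st e' e +
    (if drawn (inl (e', e), t) && (etail e \notin S)
     then x (inl (e', e), t) else 0) *: 'X^t in
  let fs e := sker st e +
    \col_i ((if drawn (inr (e, i), t) then x (inr (e, i), t) else 0) *: 'X^t) in
  State k fs (decoded st :|: [set v | is_sink v && decodable k fs v])%SET.

Fixpoint arcnc (x : coef_index -> F) (t : nat) : state :=
  match t with
  | 0 => step x finset.set0 0 (State (fun _ _ => 0) (fun _ => 0) finset.set0)
  | t'.+1 => let st := arcnc x t' in step x (stopped (decoded st)) t st
  end.

Definition decodable_at (x : coef_index -> F) (t : nat) (v : node N) : bool :=
  decodable (lker (arcnc x t)) (sker (arcnc x t)) v.

Variable R : realType.

Definition decoding_time (x : coef_index -> F) (v : node N) : \bar R :=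
  ereal_inf [set (t%:R%:E : \bar R) | t in [set t | decodable_at x t v]]%classic.

Definition network_decoding_time (x : coef_index -> F) : \bar R :=
  \big[maxe/-oo%E]_(i < n) decoding_time x (r i).

End Arcnc.

(** * Independent uniform families *)

Section Uniform.
Local Open Scope classical_set_scope.
Context {d : measure_display} {T : measurableType d} {R : realType}.
Variables (P : probability T R) (F : finType) (I : choiceType).
Variables (D : set I) (X : I -> T -> F).

(** [F] carries the discrete sigma-algebra. *)
Definition iid_uniform : Prop :=
  [/\ forall i, D i -> forall A : set F, measurable (X i @^-1` A),
      forall i, D i -> forall a, P (X i @^-1` [set a]) = (#|F|%:R^-1)%:E
    & forall (J : {fset I}) (A : I -> set F), [set` J] `<=` D ->
        P (\bigcap_(i in [set` J]) X i @^-1` A i) =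
        (\prod_(i <- J) P (X i @^-1` A i))%E].

End Uniform.

(* Main.v *)
Require Import Defs.
From mathcomp Require Import perm.
From mathcomp Require Import all_boot all_order all_algebra finmap.
From mathcomp Require Import all_classical all_reals all_analysis.
From mathcomp Require Import zify ring.

(** Let sink [v] be undecoded at times [0..t]. An undecoded node sends no ACK,
    and the set of acknowledged nodes is closed under taking children, so no
    node with an outgoing edge leading to [v] has stopped: all kernels that
    matter for [v] are full random truncated series.  By max-flow/min-cut duality
    and Hall's theorem the block matrix [[0, fs; b, 1 - k]] has, for a suitable
    selection [b] of the edges into [v], a permutation in its support, hence a
    determinant that is not the zero polynomial in the kernels; and [v] decodes
    as soon as this determinant is nonzero.  Each kernel ranges uniformly over at
    least [q ^ t] values (its coefficients at times [1..t] are free even for the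
    delayed pairs), so by a Schwartz-Zippel bound the determinant vanishes with
    probability [O(q ^ - t)].  A union bound over the sinks concludes. *)

Set Implicit Arguments.
Unset Strict Implicit.
Unset Printing Implicit Defensive.

Import Order.TTheory GRing.Theory Num.Theory.

Local Open Scope ring_scope.

(** * Hall's theorem and the Schwartz-Zippel bound *)

Section Hall.
Variables (T U : finType).

Definition neighbours (G : T -> {set U}) (S : {set T}) : {set U} :=
  [set y | [exists x in S, y \in G x]]%SET.

Lemma neighboursP (G : T -> {set U}) (S : {set T}) y :
  reflect (exists2 x, x \in S & y \in G x) (y \in neighbours G S).
Proof. by rewrite inE; apply: (iffP exists_inP). Qed.

Definition hall_condition (G : T -> {set U}) : Prop :=
  forall S : {set T}, (#|S| <= #|neighbours G S|)%N.

Definition drop_choice (G : T -> {set U}) x y : T -> {set U} :=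
  fun x' => if x' == x then (G x :\ y)%SET else G x'.

(** Rado's argument. If both deletions broke Hall's condition, the violating sets would contain [x];
    without [x] they become [A1], [A2] with [B1], [B2] no larger than them. As [y1 != y2],
    [B1 :|: B2] contains all of [G x], and adding the sizes of union and intersection gives a
    contradiction. *)
Lemma hall_drop_choice (G : T -> {set U}) x y1 y2 : hall_condition G -> y1 != y2 ->
  hall_condition (drop_choice G x y1) \/ hall_condition (drop_choice G x y2).
Proof.
move=> hG y12.
have key y (S : {set T}) : (#|neighbours (drop_choice G x y) S| < #|S|)%N ->
    exists S' : {set T}, x \notin S' /\
      (#|(neighbours G S' :|: (G x :\ y))%SET| <= #|S'|)%N.
  move=> ltS; have xS : x \in S.
    apply: contraLR ltS => xS; rewrite -leqNgt.
    rewrite (leq_trans (hG S)) // subset_leq_card //.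
    apply/fintype.subsetP => z /neighboursP[x' x'S zx']; apply/neighboursP.
    by exists x' => //; rewrite /drop_choice; case: eqP => // e; rewrite -e x'S in xS.
  exists (S :\ x)%SET; rewrite !inE eqxx; split=> //.
  move: ltS; rewrite (cardsD1 x S) xS add1n ltnS; apply: leq_trans.
  rewrite subset_leq_card //; apply/fintype.subsetP => z.
  rewrite finset.in_setU => /orP[/neighboursP[x'] | zx].
    rewrite !inE => /andP[nx x'S] zx'; apply/exists_inP.
    by exists x' => //; rewrite /drop_choice (negbTE nx).
  by apply/neighboursP; exists x; rewrite // /drop_choice eqxx.
have [h1|h1] := pselect (hall_condition (drop_choice G x y1)); first by left.
have [h2|h2] := pselect (hall_condition (drop_choice G x y2)); first by right.
exfalso.
move/existsNP: h1 => [S1 /negP]; rewrite -ltnNge => /key[A1 [x1 le1]].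
move/existsNP: h2 => [S2 /negP]; rewrite -ltnNge => /key[A2 [x2 le2]].
set B1 := (_ :|: _)%SET in le1; set B2 := (_ :|: _)%SET in le2.
have := hG (x |: (A1 :|: A2))%SET; rewrite cardsU1 !inE (negbTE x1) (negbTE x2) /=.
have := hG (A1 :&: A2)%SET.
have leI : (#|neighbours G (A1 :&: A2)%SET| <= #|(B1 :&: B2)%SET|)%N.
  rewrite subset_leq_card //; apply/fintype.subsetP => z /neighboursP[x'].
  rewrite finset.in_setI => /andP[xA1 xA2] zx'; rewrite finset.in_setI !finset.in_setU.
  by apply/andP; split; apply/orP; left; apply/neighboursP; exists x'.
have leU : (#|neighbours G (x |: (A1 :|: A2))%SET| <= #|(B1 :|: B2)%SET|)%N.
  rewrite subset_leq_card //; apply/fintype.subsetP => z /neighboursP[x'].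
  rewrite !finset.in_setU finset.in_set1 !finset.in_setD1 => /or3P[/eqP->|xA|xA] zx'.
  - rewrite zx' !andbT; case: (eqVneq z y1) => [->|]; last by rewrite orbT.
    by rewrite y12 !orbT.
  - by apply/orP; left; apply/orP; left; apply/neighboursP; exists x'.
  - by apply/orP; right; apply/orP; left; apply/neighboursP; exists x'.
have := cardsUI B1 B2; have := cardsUI A1 A2.
move: leI leU le1 le2; lia.
Qed.

(** Induction on the total number of choices: while some [x] has two, one can be deleted. Once all
    choices are single, Hall's condition on pairs is injectivity. *)
Lemma hall_marriage (G : T -> {set U}) : hall_condition G ->
  exists f : T -> U, injective f /\ forall x, f x \in G x.
Proof.
have [n] := ubnP (\sum_x #|G x|)%N; elim: n G => // n IHn G ltGn hG.
have Gn0 x : (0 < #|G x|)%N.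
  have := hG [set x]%SET; rewrite cards1 => /leq_trans; apply.
  rewrite subset_leq_card //; apply/fintype.subsetP => z /neighboursP[x'].
  by rewrite finset.in_set1 => /eqP->.
have [[x x2]|G1] := pselect (exists x, (1 < #|G x|)%N).
  have [y1 [y2 [y1x y2x y12]]] := card_gt1P x2.
  have sumlt y : y \in G x -> (\sum_x' #|drop_choice G x y x'| < n)%N.
    move=> yx; rewrite -ltnS; apply: leq_trans ltGn; rewrite ltnS.
    rewrite (bigD1 x) //= [X in (_ < X)%N](bigD1 x) //= /drop_choice eqxx.
    rewrite [in X in (_ < X + _)%N](cardsD1 y) yx add1n addSn ltnS leq_add2l.
    by apply: leq_sum => i /negbTE ->.
  have sub y x' z : z \in drop_choice G x y x' -> z \in G x'.
    by rewrite /drop_choice; case: eqP => // ->; rewrite !inE => /andP[].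
  have [h|h] := hall_drop_choice x hG y12.
    have [|f [fi fG]] := IHn _ _ h; first exact: sumlt.
    by exists f; split=> // x'; apply: sub (fG x').
  have [|f [fi fG]] := IHn _ _ h; first exact: sumlt.
  by exists f; split=> // x'; apply: sub (fG x').
have pickG x : exists y, y \in G x by have /card_gt0P := Gn0 x.
exists (fun x => xchoose (pickG x)); split; last by move=> x; apply: xchooseP.
move=> x1 x2 eqf; apply: contrapT => /eqP x12.
have := hG [set x1; x2]%SET; rewrite cards2 x12 leqNgt => /negP; apply; rewrite ltnS.
apply: (@leq_trans #|[set xchoose (pickG x1)]%SET|); last by rewrite cards1.
rewrite subset_leq_card //; apply/fintype.subsetP => z /neighboursP[x'].
have one x y y' : y \in G x -> y' \in G x -> y = y'.
  have /card_le1_eqP this : (#|G x| <= 1)%N.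
    by rewrite leqNgt; apply/negP => h; apply: G1; exists x.
  by move=> yG y'G; apply: (this y' y).
rewrite !inE => /orP[/eqP->|/eqP->] zx.
  by apply/eqP; apply: one zx (xchooseP (pickG x1)).
by rewrite eqf; apply/eqP; apply: one zx (xchooseP (pickG x2)).
Qed.

End Hall.

(** * Schwartz-Zippel bound by translations *)

Section Translation.
Variables (V B Om : finType) (A : idomainType).
Variables (y : Om -> V -> A) (shift : V -> B -> Om -> Om).
Variables (valid : {set V}) (x0 : V -> A) (D : nat) (g : (V -> A) -> A).

Definition update (x : V -> A) v a : V -> A := fun u => if u == v then a else x u.

Hypothesis shift_inj : forall v b, injective (shift v b).
Hypothesis shift_other : forall v b w u, u != v -> y (shift v b w) u = y w u.
Hypothesis shift_var : forall v w, v \in valid -> injective (fun b => y (shift v b w) v).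
Hypothesis y_invalid : forall w v, v \notin valid -> y w v = x0 v.
Hypothesis g_deg : forall x v, exists2 p : {poly A},
  (size p <= D.+1)%N & forall a, g (update x v a) = p.[a].
Hypothesis g_x0 : g x0 != 0.

(** Interpolates between the nonroot [x0] and the random point, one coordinate at a time. *)
Definition hybrid (J : {set V}) w : V -> A := fun v => if v \in J then y w v else x0 v.

(* Averaging over the translations [shift v b] replaces conditioning on the
   coordinates other than [v]. *)
Lemma zeros_hybrid (J : {set V}) : J \subset valid ->
  (#|B| * #|[pred w | g (hybrid J w) == 0%R]| <= #|J| * D * #|Om|)%N.
Proof.
have [n] := ubnP #|J|; elim: n J => // n IHn J ltJ sJ.
have [J0|[v vJ]] := set_0Vmem J.
  rewrite (eq_card0 (A := [pred w : Om | _])) ?muln0 // => w; rewrite !inE.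
  have -> : hybrid J w = x0 by apply/funext => v; rewrite /hybrid J0 inE.
  exact: negbTE.
set J' := (J :\ v)%SET.
have cJ : #|J| = #|J'|.+1 by rewrite (cardsD1 v J) vJ.
have sJ' : J' \subset valid.
  by apply: fintype.subset_trans sJ; apply: finset.subD1set.
have := IHn J' _ sJ'; rewrite -ltnS -cJ => /(_ ltJ) IH.
(* Randomising the coordinate [v] creates a zero on [bad]; every other zero for [J] is already one
   for [J']. *)
pose bad w := (g (hybrid J' w) != 0%R) && (g (hybrid J w) == 0%R).
suff le_bad : (#|B| * #|[pred w | bad w]| <= D * #|Om|)%N.
  rewrite cJ mulSn mulnDl addnC; apply: leq_trans (leq_add IH le_bad).
  rewrite -mulnDr leq_mul2l -cardUI; apply/orP; right.
  apply: leq_trans (leq_addr _ _); rewrite subset_leq_card //.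
  by apply/fintype.subsetP => w; rewrite !inE /bad => ->; rewrite andbT orbN.
(* Each [shift v b] permutes [Om], so it preserves the number of bad points. *)
have -> : (#|B| * #|[pred w | bad w]| = \sum_w #|[pred b | bad (shift v b w)]|)%N.
  transitivity (\sum_(b : B) \sum_w bad (shift v b w))%N.
    rewrite -sum_nat_const; apply: eq_bigr => b _.
    rewrite -sum1_card big_mkcond (reindex_inj (shift_inj (v := v) (b := b))) /=.
    by apply: eq_bigr => w _; rewrite inE; case: (bad _).
  rewrite exchange_big; apply: eq_bigr => w _.
  by rewrite -sum1_card [RHS]big_mkcond; apply: eq_bigr => b _; rewrite inE; case: (bad _).
(* For fixed [w] only the coordinate [v] moves with [b], so bad translations give distinct roots of
   [p]. Unless [g (hybrid J' w)] vanishes and nothing is bad, [p] is nonzero, since that is its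
   value at [x0 v]. *)
rewrite mulnC -[(#|Om| * D)%N]sum_nat_const; apply: leq_sum => w _.
have hyb' b : hybrid J' (shift v b w) = hybrid J' w.
  apply/funext => u; rewrite /hybrid !inE; case: (eqVneq u v) => //= uv.
  by rewrite shift_other.
have hyb b : hybrid J (shift v b w) = update (hybrid J' w) v (y (shift v b w) v).
  apply/funext => u; rewrite /hybrid /update !inE; case: (eqVneq u v) => [->|uv] /=.
    by rewrite vJ.
  by rewrite shift_other.
have hyb0 : hybrid J' w = update (hybrid J' w) v (x0 v).
  by apply/funext => u; rewrite /update; case: eqP => // ->; rewrite /hybrid !inE eqxx.
have [p sp gp] := g_deg (hybrid J' w) v.
have [g0|gn0] := eqVneq (g (hybrid J' w)) 0%R.
  rewrite (eq_card0 (A := [pred b : B | _])) // => b.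
  by rewrite !inE /bad hyb' g0 eqxx.
have pn0 : p != 0.
  by apply: contra gn0 => /eqP p0; rewrite hyb0 gp p0 horner0.
rewrite cardE -(size_map (fun b => y (shift v b w) v)) -ltnS.
apply: leq_trans sp; apply: max_poly_roots pn0 _ _.
  apply/allP => c /mapP[b]; rewrite mem_enum inE => /andP[_ bb] ->.
  by rewrite /root -gp -hyb.
rewrite map_inj_uniq ?enum_uniq //; apply: shift_var; exact: (fintype.subsetP sJ).
Qed.

Lemma schwartz_zippel :
  (#|B| * #|[pred w | g (y w) == 0%R]| <= #|valid| * D * #|Om|)%N.
Proof.
apply: leq_trans (zeros_hybrid (subxx valid)).
rewrite leq_mul2l; apply/orP; right; apply: eq_leq; apply: eq_card => w; rewrite !inE.
suff -> : hybrid valid w = y w by [].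
by apply/funext => v; rewrite /hybrid; case: ifPn => // /y_invalid ->.
Qed.

End Translation.

(** * Cuts and routings *)

Section Cut.
Variables (N : network) (R : realType).

Definition cut_edges (W : {set node N}) : {set edge N} :=
  [set e | (etail e \in W) && (ehead e \notin W)]%SET.

(** Summing the net outflow over [W] gives the value; edges inside [W] cancel, and unit capacities
    bound the rest. Taking [source] out of [W] in the hypothesis lets [v] be the source. *)
Lemma flow_value_le_cut v (g : edge N -> R) (W : {set node N}) :
  is_flow v g -> source \in W -> v \notin (W :\ source)%SET ->
  flow_value g <= #|cut_edges W|%:R.
Proof.
move=> [g01 gcons] sW vW.
have -> : flow_value g =
    \sum_(u in W) (\sum_(e in Out u) g e - \sum_(e in In u) g e).
  rewrite (bigD1 source) //= [X in _ + X]big1 ?addr0 => [|u /andP[uW us]].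
    rewrite [X in _ - X]big1 ?subr0 // => e.
    by rewrite inE (negbTE (source_no_in e)).
  rewrite gcons ?subrr //; apply: contra vW => /eqP <-.
  by rewrite !inE us uW.
rewrite sumrB.
have sum_by (h : edge N -> node N) :
    \sum_(u in W) \sum_(e | h e == u) g e = \sum_(e | h e \in W) g e.
  rewrite [RHS](partition_big h (mem W)) //=; apply: eq_bigr => u uW.
  by apply: eq_bigl => e; case: eqP => [->|]; rewrite ?uW ?andbF.
under eq_bigr do under eq_bigl do rewrite inE.
under [X in _ - X]eq_bigr do under eq_bigl do rewrite inE.
rewrite !sum_by (bigID (fun e => ehead e \in W)) /=.
rewrite [X in _ - X](bigID (fun e => etail e \in W)) /=.
under [X in _ - (X + _)]eq_bigl do rewrite andbC.
rewrite addrAC opprD addrA subrr add0r.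
have -> : #|cut_edges W|%:R = \sum_(e | (etail e \in W) && (ehead e \notin W)) (1 : R).
  by rewrite sumr_const; congr (_%:R); apply: eq_card => e; rewrite !inE.
rewrite addrC; apply: (@le_trans _ _ (\sum_(e | (etail e \in W) && (ehead e \notin W)) g e)).
  by rewrite gerDl oppr_le0 sumr_ge0 // => e _; have /andP[] := g01 e.
by apply: ler_sum => e _; have /andP[] := g01 e.
Qed.

Lemma max_flow_le_cut v (W : {set node N}) :
  source \in W -> v \notin (W :\ source)%SET ->
  max_flow R v <= #|cut_edges W|%:R.
Proof.
move=> sW vW; apply: ge_sup.
  exists (flow_value (fun _ : edge N => 0 : R)), (fun _ => 0) => //; split.
    by move=> e; rewrite lexx ler01.
  by move=> u _ _; rewrite !big1.
by move=> _ [g fg <-]; apply: flow_value_le_cut fg sW vW.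
Qed.

End Cut.

(** * Routings of the source symbols to a sink *)

Section Routing.
Variables (N : network) (m : nat) (v : node N).

Definition reach : rel (node N) :=
  fun u w => [exists e, (etail e == u) && (ehead e == w)].

(** The restriction matters because other edges may leave nodes that have already stopped. *)
Definition relevant (e : edge N) : bool := connect reach (ehead e) v.

Lemma connect_edge (e : edge N) : connect reach (etail e) (ehead e).
Proof. by apply: connect1; apply/existsP; exists e; rewrite !eqxx. Qed.

Lemma adjacent_relevant e' e : Defs.adjacent e' e -> relevant e -> relevant e'.
Proof. by move=> /eqP ae; apply: connect_trans; rewrite ae connect_edge. Qed.

(* [inl i] stands for the i-th source symbol on the left and for the i-th symbol
   recovered at [v] on the right. *)
Definition routes (u : 'I_m + edge N) : {set 'I_m + edge N} :=
  [set w | match u, w with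
           | inl _, inl _ => false
           | inl _, inr e => etail e == source
           | inr e, inl _ => ehead e == v
           | inr e', inr e => (e' == e) || (Defs.adjacent e' e && relevant e)
           end]%SET.

(** Edges are their own neighbours, so only a set with a source symbol and no edge into [v] needs an
    argument; there the cut bound supplies [m] further neighbours. *)
Lemma hall_routes (R : realType) : m%:R <= max_flow R v -> hall_condition routes.
Proof.
move=> mflow S.
have Sself e : inr e \in S -> inr e \in neighbours routes S.
  by move=> eS; apply/neighboursP; exists (inr e) => //; rewrite inE eqxx.
have [[i0 i0S]|noA] := pselect (exists i, inl i \in S); last first.
  rewrite subset_leq_card //; apply/fintype.subsetP => -[i|e] uS; last exact: Sself.
  by exfalso; apply: noA; exists i.
have [[e0 e0S /eqP e0v]|noB] := pselect (exists2 e, inr e \in S & ehead e = v).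
  rewrite subset_leq_card //; apply/fintype.subsetP => -[i|e] uS; last exact: Sself.
  by apply/neighboursP; exists (inr e0) => //; rewrite inE.
pose B : {set edge N} := [set e | inr e \in S]%SET.
(* Including the nodes that do not reach [v] makes every cut edge relevant. Its tail is then the
   source or the head of an edge of [S], so cut edges are neighbours of [S]. *)
pose W : {set node N} := [set u | [|| u == source, ~~ connect reach u v |
  [exists e in B, ehead e == u]]]%SET.
have sW : source \in W by rewrite inE eqxx.
have vW : v \notin (W :\ source)%SET.
  rewrite !inE connect0 /=; case: eqVneq => //= _.
  apply/negP => /exists_inP[e]; rewrite inE => eS /eqP ev.
  by apply: noB; exists e.
have := le_trans mflow (max_flow_le_cut R sW vW); rewrite ler_nat => mC.
set C := cut_edges W in mC.
have BC : [disjoint B & C].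
  rewrite disjoint_subset; apply/fintype.subsetP => e eB; rewrite !inE negb_and negbK.
  by apply/orP; right; apply/or3P/Or33/exists_inP; exists e.
have leS : (#|S| <= m + #|B|)%N.
  rewrite -[X in (_ <= X + _)%N]card_ord -cardsT.
  rewrite -(card_imset (mem [set: 'I_m]%SET) (@inl_inj _ (edge N))).
  rewrite -(card_imset (mem B) (@inr_inj 'I_m _)).
  apply: leq_trans (leq_card_setU _ _).1.
  rewrite subset_leq_card //; apply/fintype.subsetP => -[i|e] uS; rewrite inE.
    by apply/orP; left; apply/imsetP; exists i; rewrite ?inE.
  by apply/orP; right; apply/imsetP; exists e; rewrite ?inE.
have leN : (#|C| + #|B| <= #|neighbours routes S|)%N.
  have /eqP <- : #|(B :|: C)%SET| == (#|C| + #|B|)%N.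
    by rewrite addnC (leq_card_setU B C).2.
  rewrite -(card_imset (mem (B :|: C)%SET) (@inr_inj 'I_m _)).
  rewrite subset_leq_card //; apply/fintype.subsetP => _ /imsetP[e eBC ->].
  have [eB|] := boolP (e \in B); first by rewrite inE in eB; exact: Sself.
  move: eBC; rewrite finset.in_setU => /orP[->//|]; rewrite finset.in_set => /andP[eW eNW] _.
  have {eNW} he : connect reach (ehead e) v.
    by apply: contraR eNW => he; rewrite finset.in_set he orbT.
  have te : connect reach (etail e) v by apply: connect_trans (connect_edge e) he.
  move: eW; rewrite finset.in_set te orFb => /orP[es|/exists_inP[e' + e'e]].
    by apply/neighboursP; exists (inl i0); rewrite // inE.
  rewrite finset.in_set => e'S; apply/neighboursP; exists (inr e') => //.
  by rewrite inE /Defs.adjacent e'e /relevant he orbT.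
by move: leS leN mC; lia.
Qed.

End Routing.

(** * The transfer determinant *)

Section Transfer.
Variables (N : network) (m : nat).
Local Notation E := (edge N).
Local Notation var := ((E * E) + (E * 'I_m))%type.
Local Notation U := ('I_m + E)%type.

Definition transfer_entry (A : comNzRingType) (x : var -> A) (b : E -> 'I_m -> A)
    (u w : U) : A :=
  match u, w with
  | inl _, inl _ => 0
  | inl i, inr e => x (inr (e, i))
  | inr e, inl i => b e i
  | inr e', inr e => (e' == e)%:R - x (inl (e', e))
  end.

(* The block matrix [0, fs; b, 1 - k]: avoids inverting [1 - k] in the transfer
   matrix [fs (1 - k)^-1 b], and makes the determinant polynomial in [fs], [k]. *)
Definition transfer_mx (A : comNzRingType) (x : var -> A) (b : E -> 'I_m -> A) :
    'M[A]_#|{: U}| :=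
  \matrix_(i, j) transfer_entry x b (enum_val i) (enum_val j).

(** With ['X] in place of one variable, the entries have degree at most 1, so each Leibniz term has
    degree at most the order of the matrix. *)
Lemma det_transfer_degree (A : idomainType) (b : E -> 'I_m -> A) (x : var -> A) v :
  exists2 p : {poly A}, (size p <= #|{: U}|.+1)%N &
    forall a, \det (transfer_mx (update x v a) b) = p.[a].
Proof.
pose xp : var -> {poly A} := fun u => if u == v then 'X else (x u)%:P.
pose M := transfer_mx xp (fun e i => (b e i)%:P).
have sM i j : (size (M i j) <= 2)%N.
  have sx u : (size (xp u) <= 2)%N.
    by rewrite /xp; case: ifP => _; rewrite ?size_polyX // (leq_trans (size_polyC_leq1 _)).
  rewrite mxE /transfer_entry; case: (enum_val i) => i'; case: (enum_val j) => j' //.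
  - by rewrite size_poly0.
  - by rewrite (leq_trans (size_polyC_leq1 _)).
  rewrite (leq_trans (size_polyD _ _)) // geq_max size_polyN sx andbT.
  by case: eqP; rewrite ?size_poly0 // size_poly1.
exists (\det M).
  apply: (leq_trans (size_sum _ _ _)); apply/bigmax_leqP => s _.
  set c := (-1) ^+ _.
  have -> : c = ((-1) ^+ (perm.odd_perm s) : A)%:P by rewrite rmorphXn rmorphN1.
  rewrite mul_polyC (leq_trans (size_scale_leq _ _)) //.
  apply: leq_trans (size_poly_prod_leq _ _) _; rewrite leq_subLR.
  apply: (@leq_trans (\sum_(i < #|{: U}|) 2).+1); first by rewrite ltnS leq_sum.
  by rewrite sum_nat_const card_ord; lia.
move=> a; rewrite -[RHS]/(horner_eval a _) -det_map_mx; congr (\det _).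
apply/matrixP => i j; rewrite !mxE /transfer_entry.
have ex u : update x v a u = (xp u).[a].
  by rewrite /update /xp; case: ifP => _; rewrite ?hornerX ?hornerC.
case: (enum_val i) => i'; case: (enum_val j) => j'.
- by rewrite rmorph0.
- exact: ex.
- by rewrite /= /horner_eval hornerC.
by rewrite rmorphB rmorph_nat ex.
Qed.

Variable F : finFieldType.
Local Notation Fz := {fraction {poly F}}.
Variable v : node N.

(* The diagonal of [1 - k] is stuck at 1, so the other entries selected by [sigma]
   get weight [1 / z]: once their rows are scaled by [z], setting [z = 0] leaves the
   permutation matrix of [sigma]. *)
Lemma transfer_nonsingular (sigma : U -> U) :
  injective sigma -> (forall u, sigma u \in routes v u) ->
  exists x : var -> Fz, exists b : E -> 'I_m -> Fz,
  [/\ forall e' e, ~~ (Defs.adjacent e' e && relevant v e) -> x (inl (e', e)) = 0,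
      forall e i, etail e != source -> x (inr (e, i)) = 0,
      forall e i, ehead e != v -> b e i = 0
    & \det (transfer_mx x b) != 0].
Proof.
move=> sinj sroutes.
pose zeta : Fz := (tofrac 'X)^-1.
have z0 : tofrac 'X != 0 :> Fz by rewrite tofrac_eq0 polyX_eq0.
(* The minus sign compensates that of [1 - k]; an edge fixed by [sigma] uses the diagonal 1. The
   pole at [z = 0] is harmless, as the point only witnesses that the determinant is not identically
   zero. *)
pose x (w : var) : Fz := match w with
  | inl (e', e) => if (sigma (inr e') == inr e) && (e' != e) then - zeta else 0
  | inr (e, i) => if sigma (inl i) == inr e then zeta else 0
  end.
pose b e i : Fz := if sigma (inr e) == inl i then zeta else 0.
exists x, b; split.
- move=> e' e h; rewrite /x; case: ifP => // /andP[/eqP se ne].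
  have := sroutes (inr e'); rewrite se inE (negbTE ne) /= => h'.
  by rewrite h' in h.
- move=> e i h; rewrite /x; case: eqP => // se.
  by have := sroutes (inl i); rewrite se inE (negbTE h).
- move=> e i h; rewrite /b; case: eqP => // se.
  by have := sroutes (inr e); rewrite se inE (negbTE h).
(* Rows fixed by [sigma] stay unscaled, so as to keep their diagonal 1. [n] below is the scaled
   entry: 1 where selected, ['X] on the diagonal of a moved edge. *)
pose c u : {poly F} := if sigma u == u then 1 else 'X.
pose isr (u : U) := if u is inr _ then true else false.
pose n u w : {poly F} := (sigma u == w)%:R +
  (if [&& u == w, isr u & sigma u != u] then 'X else 0).
pose M := \matrix_(i < #|{: U}|, j < #|{: U}|) n (enum_val i) (enum_val j).
pose d : 'rV[Fz]_#|{: U}| := \row_i tofrac (c (enum_val i)).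
have eM : diag_mx d *m transfer_mx x b = map_mx (@tofrac _) M.
  apply/matrixP => i j; rewrite mul_diag_mx !mxE.
  set u := enum_val i; set w := enum_val j.
  rewrite /n /c; case: u w => [i1|e1] [i2|e2]; rewrite /transfer_entry /x /b /isr.
  - have -> : (sigma (inl i1) == inl i2) = false.
      by apply/eqP => h; have := sroutes (inl i1); rewrite h inE.
    by rewrite /= andbF mulr0 addr0 tofrac0.
  - have -> : (sigma (inl i1) == inl i1) = false.
      by apply/eqP => h; have := sroutes (inl i1); rewrite h inE.
    by case: eqP => _; rewrite /= addr0 ?mulfV ?mulr0 ?tofrac1 ?tofrac0.
  - have [->|ne] := eqVneq (sigma (inr e1)) (inl i2).
      by rewrite /= addr0 mulfV ?tofrac1.
    by rewrite /= mulr0 addr0 tofrac0.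
  - have [s1|ns1] := eqVneq (sigma (inr e1)) (inr e1).
      rewrite s1 /= !andbF tofrac1 mul1r addr0 (inj_eq (@inr_inj _ _)).
      by rewrite andbN subr0; case: eqP => _; rewrite ?tofrac1 ?tofrac0.
    rewrite /= !andbT (inj_eq (@inr_inj _ _)).
    have [s2|ns2] := eqVneq (sigma (inr e1)) (inr e2).
      have -> /= : (e1 == e2) = false.
        by apply/eqP => e12; rewrite s2 e12 eqxx in ns1.
      by rewrite sub0r opprK mulfV // addr0 tofrac1.
    by rewrite subr0 add0r; case: eqP => _; rewrite ?mulr0 ?mulr1 ?tofrac0.
have dM : \det M != 0.
  pose tau (i : 'I_#|{: U}|) : 'I_#|{: U}| := enum_rank (sigma (enum_val i)).
  have tauI : injective tau by move=> i j /enum_rank_inj/sinj/enum_val_inj.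
  have eM0 : map_mx (horner_eval 0) M = perm_mx (perm tauI).
    apply/matrixP => i j; rewrite !mxE permE /tau /n /horner_eval hornerD.
    rewrite (can2_eq enum_rankK enum_valK).
    have -> z : (if z then 'X else 0 : {poly F}).[0] = 0.
      by case: z; rewrite ?hornerX ?horner0.
    rewrite addr0.
    by case: (_ == _); rewrite ?hornerC ?horner0.
  apply: contraTneq (oner_neq0 F) => dM0; rewrite negbK.
  have := det_map_mx (horner_eval (0 : F)) M; rewrite dM0 rmorph0 /= eM0 det_perm.
  by move=> /eqP; rewrite signr_eq0.
have : tofrac (\det M) != 0 :> Fz by rewrite tofrac_eq0.
rewrite -(det_map_mx (@tofrac {poly F})) -eM det_mulmx.
by rewrite mulf_eq0 negb_or => /andP[].
Qed.

(** If a row [u] kills the kernels into [v], then [u] followed by the negated products of [u] with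
    the edge kernels is a left null vector of the transfer matrix: edge columns express the
    recursion for [f], the others see only edges into [v]. Invertibility forces [u = 0]. *)
Lemma rank_kernel_mx (k : E -> E -> Fz) (fs : E -> 'cV[Fz]_m)
    (b : E -> 'I_m -> Fz) (x : var -> Fz) (f : E -> 'cV[Fz]_m) :
  (forall e, relevant v e -> f e = fs e + \sum_e' k e' e *: f e') ->
  (forall e' e, ~~ Defs.adjacent e' e -> k e' e = 0) ->
  (forall e i, ehead e != v -> b e i = 0) ->
  (forall e i, x (inr (e, i)) = fs e i 0) ->
  (forall e' e, x (inl (e', e)) = if relevant v e then k e' e else 0) ->
  \det (transfer_mx x b) != 0 ->
  \rank (kernel_mx f v) = m.
Proof.
move=> fE kadj b0 xr xl detn0; apply/eqP; apply: inj_row_free => u uf0.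
pose dot (g : 'cV[Fz]_m) := \sum_i u 0 i * g i 0.
have dotF e : ehead e = v -> dot (f e) = 0.
  move=> ev; have eI : e \in In v by rewrite inE ev.
  have := congr1 (fun A : 'rV_ _ => A 0 (enum_rank_in eI e)) uf0; rewrite !mxE => <-.
  by apply: eq_bigr => i _; rewrite mxE enum_rankK_in.
(* [x] has no kernels into edges that do not lead to [v]: there [f] becomes [fs]. *)
pose f' e := if relevant v e then f e else fs e.
pose w (s : U) := match s with inl i => u 0 i | inr e => - dot (f' e) end.
have key s : \sum_t w t * transfer_entry x b t s = 0.
  rewrite big_sumType /=; case: s => [j|e2].
    rewrite big1 ?add0r => [|i _]; last by rewrite mulr0.
    apply: big1 => e _; have [ev|/b0 ->] := eqVneq (ehead e) v; last by rewrite mulr0.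
    by rewrite /f' /relevant ev connect0 dotF // oppr0 mul0r.
  have -> : \sum_(i : 'I_m) u 0 i * x (inr (e2, i)) = dot (fs e2).
    by apply: eq_bigr => i _; rewrite xr.
  under eq_bigr do rewrite mulrBr.
  rewrite sumrB (bigD1 e2) //= eqxx mulr1.
  rewrite [X in _ + (_ + X - _)]big1 => [|e /negbTE ->]; last first.
    by rewrite mulr0.
  rewrite addr0 {1}/f'; case: ifP => r2; last first.
    rewrite big1 ?subr0 ?subrr // => e _; by rewrite xl r2 mulr0.
  have -> : \sum_e - dot (f' e) * x (inl (e, e2)) = dot (fs e2) - dot (f e2).
    transitivity (- \sum_e \sum_i u 0 i * (k e e2 * f e i 0)).
      rewrite -sumrN; apply: eq_bigr => e _; rewrite mulNr; congr (- _).
      rewrite xl r2 mulr_suml; apply: eq_bigr => i _.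
      have [ae|/kadj->] := boolP (Defs.adjacent e e2); last by rewrite mul0r !mulr0.
      (* An edge feeding a relevant edge is relevant, so [f'] is [f] here. *)
      by rewrite /f' (adjacent_relevant ae r2) -mulrA [f e i 0 * _]mulrC.
    rewrite exchange_big /= -[RHS]opprB; congr (- _).
    rewrite fE // -sumrB; apply: eq_bigr => i _.
    rewrite mxE summxE mulrDr addrC addKr mulr_sumr.
    by apply: eq_bigr => e _; rewrite mxE.
  ring.
have w0 : \row_(j < #|{: U}|) w (enum_val j) = 0.
  have uM : transfer_mx x b \in unitmx by rewrite unitmxE unitfE.
  rewrite -[LHS](mulmxK uM) -[RHS](mul0mx _ (invmx (transfer_mx x b))); congr (_ *m _).
  apply/rowP => j; rewrite !mxE; have := key (enum_val j).
  have h := onW_bij predT (enum_val_bij U); rewrite (reindex _ h) /= => key'.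
  apply: etrans key'.
  by apply: eq_bigr => t _; rewrite !mxE.
apply/rowP => i; have := congr1 (fun A : 'rV_ _ => A 0 (enum_rank (inl i))) w0.
by rewrite !mxE enum_rankK.
Qed.

End Transfer.

(** * Global encoding kernels *)

Section GlobalKernels.
Variables (N : network) (Z : {set edge N * edge N}).
Local Notation E := (edge N).

Definition undelayed (e' e : E) : bool := Defs.adjacent e' e && ((e', e) \notin Z).

(** On a minimal nonempty stable subset of [S] the map [p] is a permutation, and an orbit would be a
    directed cycle that avoids [Z]. *)
Lemma no_undelayed_successor (p : E -> E) (S : {set E}) :
  delay_set Z -> (forall e, e \in S -> p e \in S) ->
  (forall e, e \in S -> undelayed e (p e)) -> S = finset.set0.
Proof.
move=> [_ Zcycle _] pS pZ; apply/eqP; apply: contrapT => /negP S0.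
pose P (C : {set E}) := (C != finset.set0) && (p @: C \subset C)%SET.
have PS : P S.
  by rewrite /P S0; apply/fintype.subsetP => _ /imsetP[e eS ->]; exact: pS.
have [C /minsetP[/andP[C0 pC] Cmin] CS] := minset_exists PS.
have pCC : (p @: C)%SET = C.
  apply: (Cmin _ _ pC); rewrite /P imset_eq0 C0 /=; apply: imsetS.
  by apply/fintype.subsetP => _ /imsetP[e eC ->]; apply: (fintype.subsetP pC); exact: imset_f.
have pinj : {in C &, injective p} by apply/imset_injP; rewrite pCC.
have [x xC] := set0Pn _ C0.
have pstable : {in C, forall e, p e \in C}.
  by move=> e eC; move: (imset_f p eC); rewrite pCC.
have oC : {subset orbit p x <= C}.
  move=> e; rewrite -fconnect_orbit => /iter_findex <-.
  by elim: (findex _ _ _) => //= n; exact: pstable.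
have cyc := cycle_orbit_in pstable pinj xC.
have [|e eo] := Zcycle (orbit p x).
  split; first by move=> o0; have := mem_last x (orbit p x); have := in_orbit p x; rewrite o0.
  apply/andP; split; last exact: orbit_uniq.
  apply: (sub_in_cycle (P := mem C)) cyc; last by apply/allP.
  by move=> a b aC _ /eqP <-; have /andP[] := pZ _ (fintype.subsetP CS _ aC).
have /eqP <- := next_cycle cyc eo.
by apply/negP; have /andP[] := pZ _ (fintype.subsetP CS _ (oC _ eo)).
Qed.

(** Where [u] is nonzero, some term of its equation is too, so the support of [u] is closed under an
    undelayed successor map. *)
Lemma undelayed_fixpoint (F : fieldType) (M : E -> E -> F) (u : E -> F) :
  delay_set Z -> (forall e' e, M e' e != 0 -> undelayed e' e) ->
  (forall e', u e' = \sum_e M e' e * u e) -> forall e, u e = 0.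
Proof.
move=> hZ hM hu.
pose p e' := odflt e' [pick e | (M e' e != 0) && (u e != 0)].
have pP e' : u e' != 0 -> (M e' (p e') != 0) && (u (p e') != 0).
  rewrite /p; case: pickP => //= h; rewrite hu big1 ?eqxx // => e _.
  by have /negbT := h e; rewrite negb_and !negbK => /orP[]/eqP->; rewrite ?mul0r ?mulr0.
have S0 := @no_undelayed_successor p [set e | u e != 0]%SET hZ.
move=> e; apply/eqP; apply: contrapT => /negP ue.
have : e \in [set e | u e != 0]%SET by rewrite inE.
rewrite S0 ?inE // => e'; rewrite !inE => /pP/andP[] // + _; exact: hM.
Qed.

Variables (F : finFieldType) (m : nat).
Local Notation Fz := {fraction {poly F}}.
Variables (k : E -> E -> {poly F}) (fs : E -> 'cV[{poly F}]_m).

Definition adj_kernel e' e : {poly F} := if Defs.adjacent e' e then k e' e else 0.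
Definition source_kernel e : 'cV[{poly F}]_m := if etail e == source then fs e else 0.

(** One linear system replaces the case split: no adjacent pair ends in an edge of [Out source],
    since no edge enters the source. *)
Lemma global_kernelsE (f : E -> 'cV[Fz]_m) : global_kernels k fs f <->
  forall e, f e = map_mx (@tofrac _) (source_kernel e) +
    \sum_e' tofrac (adj_kernel e' e) *: f e'.
Proof.
suff rhs e : (if etail e == source then map_mx (@tofrac {poly F}) (fs e)
    else \sum_(e' in In (etail e)) tofrac (k e' e) *: f e') =
    map_mx (@tofrac _) (source_kernel e) + \sum_e' tofrac (adj_kernel e' e) *: f e'.
  by split=> h e; rewrite h rhs.
rewrite /source_kernel; case: eqP => es.
  rewrite big1 ?addr0 // => e' _; rewrite /adj_kernel /Defs.adjacent es.
  by rewrite (negbTE (source_no_in e')) tofrac0 scale0r.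
rewrite map_mx0 add0r [RHS](bigID (fun e' => Defs.adjacent e' e)) /=.
rewrite [X in _ + X]big1 ?addr0 => [|e' /negbTE a]; last first.
  by rewrite /adj_kernel a tofrac0 scale0r.
apply: eq_big => [e'|e' a]; first by rewrite inE.
by rewrite inE in a; rewrite /adj_kernel /Defs.adjacent a.
Qed.

(** At [z = 0] only undelayed pairs remain in [k], so [1 - k] has trivial kernel by
    [undelayed_fixpoint]. Its determinant is thus nonzero and the system for [f] is solvable. *)
Lemma global_kernels_exist : delay_set Z ->
  (forall e' e, (k e' e)`_0 != 0 -> undelayed e' e) ->
  exists f : E -> 'cV[Fz]_m, global_kernels k fs f.
Proof.
move=> hZ k0.
pose A : 'M[{poly F}]_#|E| :=
  \matrix_(i, j) ((i == j)%:R - adj_kernel (enum_val i) (enum_val j)).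
have detA : \det A != 0.
  pose A0 := map_mx (horner_eval 0) A.
  have uA0 : A0 \in unitmx.
    rewrite -unitmx_tr -row_free_unit; apply: inj_row_free => u uA.
    have Au i : \sum_j A0 i j * u 0 j = 0.
      have := congr1 (fun B : 'rV_ _ => B 0 i) uA; rewrite !mxE => h; apply: etrans h.
      by apply: eq_bigr => j _; rewrite !mxE mulrC.
    pose M e' e := (adj_kernel e' e)`_0.
    have hM e' e : M e' e != 0 -> undelayed e' e.
      by rewrite /M /adj_kernel; case: ifP => _; [exact: k0 | rewrite coef0 eqxx].
    apply/rowP => i; rewrite [RHS]mxE -[i]enum_valK.
    apply: (undelayed_fixpoint (u := fun e => u 0 (enum_rank e)) hZ hM) => e'.
    have := Au (enum_rank e'); have h := onW_bij predT (enum_rank_bij E).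
    rewrite (reindex _ h) /=.
    have -> : \sum_e A0 (enum_rank e') (enum_rank e) * u 0 (enum_rank e) =
        u 0 (enum_rank e') - \sum_e M e' e * u 0 (enum_rank e).
      transitivity (\sum_e ((e' == e)%:R * u 0 (enum_rank e) - M e' e * u 0 (enum_rank e))).
        apply: eq_bigr => e _; rewrite !mxE !enum_rankK (inj_eq enum_rank_inj) -mulrBl.
        by rewrite /M -horner_coef0 rmorphB rmorph_nat.
      rewrite sumrB; congr (_ - _); rewrite (bigD1 e') //= eqxx mul1r big1 ?addr0 // => e.
      by rewrite eq_sym => /negbTE ->; rewrite mul0r.
    by move/eqP; rewrite subr_eq0 => /eqP.
  apply: contraTneq uA0 => A0'; rewrite unitmxE det_map_mx A0' rmorph0.
  by rewrite unitr0.
pose B := map_mx (@tofrac {poly F}) A.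
have uB : B \in unitmx by rewrite unitmxE unitfE det_map_mx tofrac_eq0.
pose S : 'M[Fz]_(m, #|E|) := \matrix_(i, j) tofrac (source_kernel (enum_val j) i 0).
pose G := S *m invmx B.
have GB : G *m B = S by rewrite mulmxKV.
clearbody G.
exists (fun e => col (enum_rank e) G); apply/global_kernelsE => e.
apply/colP => i; rewrite [LHS]mxE.
have := congr1 (fun D : 'M[Fz]_(m, #|E|) => D i (enum_rank e)) GB.
rewrite mxE [RHS]mxE enum_rankK.
rewrite !mxE summxE => <-.
under eq_bigr do rewrite !mxE enum_rankK rmorphB rmorph_nat mulrBr.
rewrite sumrB (bigD1 (enum_rank e)) //= eqxx mulr1 big1 => [|j /negbTE ->]; last first.
  by rewrite mulr0.
rewrite addr0 (reindex _ (onW_bij predT (enum_rank_bij E))) /=.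
rewrite -[LHS](subrK (\sum_e' G i (enum_rank e') * tofrac (adj_kernel e' e))).
congr (_ - _ + _); apply: eq_bigr => e' _; first by rewrite enum_rankK.
by rewrite !mxE mulrC.
Qed.
End GlobalKernels.

(** * Runs of the algorithm *)

Section ArcncFacts.
Variables (N : network) (F : finFieldType) (m d : nat).
Variables (r : 'I_d -> node N) (Z : {set edge N * edge N}).
Local Notation E := (edge N).
Local Notation var := ((E * E) + (E * 'I_m))%type.
Local Notation Fz := {fraction {poly F}}.
Local Notation draws := (coef_index N m -> F).
Implicit Types (x : draws) (D : {set node N}).

Lemma ackedE D v : (v \in acked r D) =
  (is_sink r v ==> (v \in D)) && [forall e in Out v, ehead e \in acked r D].
Proof.
rewrite {1}/acked -fixsetK ?inE // => A B AB.
apply/fintype.subsetP => u; rewrite !inE => /andP[-> /forall_inP h] /=.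
by apply/forall_inP => e /h; exact: (fintype.subsetP AB).
Qed.

(** Induction along a path: the undecoded sink withholds its ACK, and each node waits for its
    child. *)
Lemma reach_sink_not_acked D i v :
  r i \notin D -> connect (@reach N) v (r i) -> v \notin acked r D.
Proof.
move=> riD /connectP[p]; elim: p v => [|w p IHp] v /= => [_ <-|/andP[+ pw] lw].
  rewrite ackedE negb_and; apply/orP; left.
  by rewrite negb_imply riD andbT; apply/existsP; exists i.
move=> /existsP[e /andP[/eqP te /eqP he]].
rewrite ackedE negb_and; apply/orP; right.
apply/forall_inPn; exists e; first by rewrite inE te.
by rewrite he IHp.
Qed.

Lemma relevant_not_stopped D i e :
  r i \notin D -> relevant (r i) e -> etail e \notin stopped r D.
Proof.
move=> riD re; rewrite inE; apply/forall_inPn; exists e; first by rewrite inE.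
exact: reach_sink_not_acked riD re.
Qed.

(** The kernel that would result if no node ever stopped. *)
Definition kernel_series x t (w : var) : {poly F} :=
  \sum_(s < t.+1) (if drawn Z (w, val s) then x (w, val s) else 0) *: 'X^s.

Lemma lker_coef0 x t e' e :
  (Defs.lker (arcnc r Z x t) e' e)`_0 != 0 -> undelayed Z e' e.
Proof.
elim: t => [|t IHt] /=; last by rewrite coefD coefZ coefXn mulr0 addr0.
rewrite add0r coefZ coefXn mulr1 /undelayed.
by case: ifP => [/andP[]//|]; rewrite eqxx.
Qed.

Lemma skerE x t e i : Defs.sker (arcnc r Z x t) e i 0 = kernel_series x t (inr (e, i)).
Proof.
rewrite /kernel_series; elim: t => [|t IHt]; first by rewrite big_ord1 /= !mxE add0r.
by rewrite big_ord_recr -IHt /= !mxE.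
Qed.

Lemma decodedP x t v : v \in decoded (arcnc r Z x t) ->
  exists2 s, (s <= t)%N & decodable_at r Z x s v.
Proof.
elim: t => [|t IHt] /=; rewrite finset.in_setU.
  rewrite !inE => /andP[_ dv]; by exists 0%N.
case/orP=> [/IHt[s st ds]|]; first by exists s => //; exact: leqW.
by rewrite inE => /andP[_ dv]; exists t.+1.
Qed.

(** The nodes stopped at time [t] are determined by the decodings before [t], hence the strict
    inequality; none is the tail of a relevant edge. *)
Lemma lker_unstopped x t i e' e :
  (forall s, (s < t)%N -> ~~ decodable_at r Z x s (r i)) -> relevant (r i) e ->
  Defs.lker (arcnc r Z x t) e' e = kernel_series x t (inl (e', e)).
Proof.
move=> + re; rewrite /kernel_series; elim: t => [|t IHt] nd.
  by rewrite big_ord1 /= add0r inE andbT.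
rewrite big_ord_recr -IHt => [|s st]; last by apply: nd; exact: leqW.
rewrite /= (relevant_not_stopped _ re) ?andbT //.
by apply/negP => /decodedP[s st]; apply/negP/nd.
Qed.

(** Reduces the infinite family of draws to the finitely many made up to time [t]. *)
Lemma arcnc_ext x x' t :
  (forall w s, (s <= t)%N -> drawn Z (w, s) -> x (w, s) = x' (w, s)) ->
  arcnc r Z x t = arcnc r Z x' t.
Proof.
have step_ext S st s : (forall w, drawn Z (w, s) -> x (w, s) = x' (w, s)) ->
    step r Z x S s st = step r Z x' S s st.
  move=> xx'; rewrite /step; set k := (fun _ => _).
  set k' := (fun e' e => _ + (if _ then x' _ else _) *: _).
  have -> : k = k'.
    apply/funext => e'; apply/funext => e; rewrite /k /k'.
    by case: ifP => // /andP[/xx' ->].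
  set f := (fun e => sker st e + _).
  have -> : f = (fun e => sker st e +
      \col_i ((if drawn Z (inr (e, i), s) then x' (inr (e, i), s) else 0) *: 'X^s)).
    apply/funext => e; rewrite /f; congr (_ + _); apply/colP => i; rewrite !mxE.
    by case: ifP => // /xx' ->.
  by [].
elim: t => [|t IHt] xx' /=; first by apply: step_ext => w; exact: xx'.
rewrite IHt => [|w s st]; last by apply: xx'; exact: leqW.
by apply: step_ext => w; exact: xx'.
Qed.

Definition variable_of (v : node N) (w : var) : bool :=
  match w with
  | inl (e', e) => Defs.adjacent e' e && relevant v e
  | inr (e, _) => etail e == source
  end.

(** Kernels into edges not leading to [v] are zeroed: stopping may have cut them short, and they do
    not affect [v]. *)
Definition transfer_point x t v (w : var) : Fz :=
  if variable_of v w then tofrac (kernel_series x t w) else 0.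

(** With no decoding before [t], the transfer point agrees with the actual kernels on relevant
    edges, so [rank_kernel_mx] applies. *)
Lemma decodable_of_det x t i (b : E -> 'I_m -> Fz) :
  delay_set Z -> (forall s, (s < t)%N -> ~~ decodable_at r Z x s (r i)) ->
  (forall e j, ehead e != r i -> b e j = 0) ->
  \det (transfer_mx (transfer_point x t (r i)) b) != 0 ->
  decodable_at r Z x t (r i).
Proof.
move=> hZ nd b0 detn0; apply/asboolP.
have [f ff] := global_kernels_exist (Defs.sker (arcnc r Z x t)) hZ (@lker_coef0 x t).
exists f => //; move/global_kernelsE: ff => fE.
apply: (rank_kernel_mx (fun e _ => fE e) _ b0 _ _ detn0).
- by move=> e' e /negbTE a; rewrite /adj_kernel a tofrac0.
- move=> e j; rewrite mxE /source_kernel /transfer_point /=; case: ifP => // _.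
    by rewrite skerE.
  by rewrite mxE tofrac0.
move=> e' e; rewrite /transfer_point /adj_kernel /=.
case: ifP => [/andP[-> re]|]; first by rewrite re (lker_unstopped _ nd).
by case: (Defs.adjacent e' e) => /= [->//|_]; rewrite tofrac0 if_same.
Qed.

End ArcncFacts.

(** * Probability of not decoding *)

Section UniformLaw.
Local Open Scope classical_set_scope.
Context (d : measure_display) (T : measurableType d) (R : realType).
Variables (P : probability T R) (F : finType) (I : choiceType).
Variables (D : set I) (X : I -> T -> F).
Hypothesis iidX : iid_uniform P D X.
Variables (L : finType) (iota : L -> I).
Hypotheses (iota_inj : injective iota) (iotaD : forall l, D (iota l)).

Definition sample w : {ffun L -> F} := [ffun l => X (iota l) w].

Let J : {fset I} := [fset i in [seq iota l | l <- enum L]]%fset.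

Let in_J i : (i \in J) <-> exists l, i = iota l.
Proof.
rewrite !inE; split=> [/mapP[l _ ->]|[l ->]]; first by exists l.
by apply/mapP; exists l; rewrite ?mem_enum.
Qed.

(** By injectivity of [iota], a singleton at each [iota l]. *)
Let cyl (a : {ffun L -> F}) i : set F := [set b | forall l, iota l = i -> b = a l].

Let cylE a : [set w | sample w = a] = \bigcap_(i in [set` J]) X i @^-1` cyl a i.
Proof.
apply/seteqP; split=> w /=.
  by move=> <- i _ l li; rewrite /sample ffunE li.
move=> h; apply/ffunP => l; rewrite ffunE.
by apply: (h (iota l)) => //; apply/in_J; exists l.
Qed.

Lemma sample_law1 a :
  measurable [set w | sample w = a] /\
  P [set w | sample w = a] = ((#|F|%:R^-1) ^+ #|L|)%:E.
Proof.
have [Xm Xu Xi] := iidX; rewrite cylE; split.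
  apply: fin_bigcap_measurable => [|i /= /in_J[l ->]]; first exact: finite_fset.
  exact: Xm.
rewrite Xi => [|i /= /in_J[l ->]]; last exact: iotaD.
rewrite (eq_big_seq (fun => (#|F|%:R^-1)%:E)) => [|i /in_J[l ->]]; last first.
  rewrite -(Xu _ (iotaD l) (a l)); congr (P (_ @^-1` _)).
  by apply/seteqP; split=> b /= => [h|-> l' /iota_inj ->]; first exact: h.
rewrite prodEFin big_const_seq count_predT iter_mulr_1; congr ((_ ^+ _)%:E).
rewrite [size _](_ : _ = #|` J|) // card_fseq undup_id.
  by rewrite (size_map iota) -cardE.
by rewrite map_inj_uniq ?enum_uniq.
Qed.

(** The event is a finite disjoint union of atoms of equal mass, so probability becomes counting. *)
Lemma sample_law (Q : pred {ffun L -> F}) :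
  measurable [set w | Q (sample w)] /\
  P [set w | Q (sample w)] = (#|Q|%:R / (#|F| ^ #|L|)%:R)%:E.
Proof.
pose A : {fset {ffun L -> F}} := [fset a in enum Q]%fset.
have -> : [set w | Q (sample w)] =
    \big[setU/set0]_(a <- A) [set w | sample w = a].
  rewrite -bigcup_fset; apply/seteqP; split=> w /=.
    by move=> Qw; exists (sample w) => //=; rewrite !inE mem_enum.
  by move=> [a + /= ->]; rewrite /= !inE mem_enum.
split; first by apply: bigsetU_measurable => a _; exact: (sample_law1 a).1.
rewrite measure_fbigsetU; last 2 first.
- by move=> a _; exact: (sample_law1 a).1.
- by move=> a b _ _ [w [/= -> ->]].
rewrite (eq_bigr _ (fun a _ => (sample_law1 a).2)) sumEFin.
rewrite big_const_seq count_predT iter_addr_0.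
have -> : size A = #|Q|.
  by rewrite -[LHS]/(#|` A|) card_fseq undup_id ?enum_uniq // -cardE.
by rewrite natrX exprVn mulr_natl.
Qed.

End UniformLaw.

(** * Counting the draws that leave a sink undecoded *)

Section Counting.
Variables (N : network) (F : finFieldType) (m d : nat).
Variables (r : 'I_d -> node N) (Z : {set edge N * edge N}) (t : nat).
Local Notation E := (edge N).
Local Notation var := ((E * E) + (E * 'I_m))%type.
Local Notation Fz := {fraction {poly F}}.

Definition draw_index : finType :=
  {l : var * 'I_t.+1 | drawn Z (l.1, nat_of_ord l.2)}.

Definition coef_of (l : draw_index) : coef_index N m :=
  ((val l).1, nat_of_ord (val l).2).

Lemma coef_of_inj : injective coef_of.
Proof. by move=> [[w s] ?] [[w' s'] ?] [ww /val_inj ss]; apply: val_inj; rewrite /= ww ss. Qed.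

Lemma coef_of_drawn l : drawn Z (coef_of l).
Proof. exact: valP l. Qed.

Local Notation Om := {ffun draw_index -> F}.

(** At most one term survives, as [coef_of] is injective; other coefficients default to 0. *)
Definition extend (a : Om) : coef_index N m -> F :=
  fun c => \sum_(l | coef_of l == c) a l.

Lemma extend_coef_of a l : extend a (coef_of l) = a l.
Proof.
rewrite /extend (bigD1 l) //= big1 ?addr0 // => l' /andP[/eqP/coef_of_inj -> ].
by rewrite eqxx.
Qed.

Lemma coef_ofP w s : (s <= t)%N -> drawn Z (w, s) -> exists l, coef_of l = (w, s).
Proof.
move=> st dws; pose o : 'I_t.+1 := Ordinal (st : (s < t.+1)%N).
pose D (l : var * 'I_t.+1) := drawn Z (l.1, nat_of_ord l.2).
have dwo : D (w, o) by [].
by exists (exist D (w, o) dwo).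
Qed.

(** Moves only times 1 to [t]: the time-0 coefficient of a delayed pair is not drawn. *)
Definition shift (w : var) (b : {ffun 'I_t -> F}) (a : Om) : Om :=
  [ffun l => a l + (if (coef_of l).1 == w
                    then \sum_(s < t | s.+1 == (coef_of l).2) b s else 0)].

Lemma extend_shift w b a u s : (s <= t)%N -> drawn Z (u, s) ->
  extend (shift w b a) (u, s) = extend a (u, s) +
    (if u == w then \sum_(s' < t | s'.+1 == s) b s' else 0).
Proof. by move=> st /(coef_ofP st)[l us]; rewrite -us !extend_coef_of ffunE us. Qed.

Lemma coef_kernel_series (x : coef_index N m -> F) (w : var) s : (s <= t)%N ->
  (kernel_series Z x t w)`_s = if drawn Z (w, s) then x (w, s) else 0.
Proof.
move=> st; rewrite coef_sum (bigD1 (Ordinal (st : (s < t.+1)%N))) //= coefZ coefXn eqxx mulr1.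
rewrite big1 ?addr0 // => s'; rewrite -val_eqE eq_sym /= => /negbTE ns.
by rewrite coefZ coefXn ns mulr0.
Qed.

Definition undecoded i (a : Om) : bool :=
  [forall s : 'I_t.+1, ~~ decodable_at r Z (extend a) s (r i)].

(** Draws leaving the sink undecoded are zeros of the transfer determinant; Schwartz-Zippel applies
    with [#|F| ^ t] translations per kernel. *)
Lemma card_undecoded (R : realType) i : m%:R <= max_flow R (r i) -> delay_set Z ->
  (#|F| ^ t * #|[pred a | undecoded i a]| <=
    #|{: var}| * #|{: 'I_m + E}| * #|F| ^ #|draw_index|)%N.
Proof.
move=> mflow hZ.
have [sigma [sinj sroutes]] := hall_marriage (hall_routes mflow).
have [x0 [b [x0l x0r b0 detn0]]] := transfer_nonsingular F sinj sroutes.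
pose y (a : Om) := transfer_point Z (extend a) t (r i).
pose g (x : var -> Fz) := \det (transfer_mx x b).
pose valid : {set var} := [set w | variable_of (r i) w]%SET.
have shift_inj w c : injective (shift w c).
  by move=> a a' /ffunP h; apply/ffunP => l; have := h l; rewrite !ffunE => /addIr.
have shift_other w c a u : u != w -> y (shift w c a) u = y a u.
  move=> uw; rewrite /y /transfer_point; case: ifP => // _; congr tofrac.
  apply: eq_bigr => s _; case: ifP => // ds; rewrite extend_shift ?(negbTE uw) ?addr0 //. 
  by have := ltn_ord s; rewrite ltnS.
have shift_var w a : w \in valid -> injective (fun c => y (shift w c a) w).
  rewrite inE => vw c c'; rewrite /y /transfer_point vw => /eqP.
  rewrite tofrac_eq => /eqP sc; apply/ffunP => s.
  have dw : drawn Z (w, s.+1).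
    by case: w vw {sc} => [[e' e]|[e j]] //= /andP[-> _].
  have := congr1 (fun p : {poly F} => p`_s.+1) sc; rewrite /= !coef_kernel_series // dw.
  rewrite !extend_shift // eqxx => /addrI.
  by rewrite !(big_pred1 s).
have y_invalid a w : w \notin valid -> y a w = x0 w.
  rewrite inE /y /transfer_point => nw; rewrite (negbTE nw).
  by case: w nw => [[e' e]|[e j]] nw; rewrite ?x0l ?x0r.
have := @schwartz_zippel _ _ _ _ _ _ _ _ _ g shift_inj shift_other shift_var y_invalid
  (det_transfer_degree b) detn0.
rewrite !card_ffun card_ord => bound.
apply: (@leq_trans (#|valid| * #|{: 'I_m + E}| * #|F| ^ #|draw_index|)); last first.
  by rewrite !leq_mul2r max_card !orbT.
apply: leq_trans bound; rewrite leq_mul2l; apply/orP; right.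
rewrite subset_leq_card //; apply/fintype.subsetP => a; rewrite !inE => /forallP und.
(* A nonzero determinant would let the sink decode at [t], the last time that [undecoded] covers. *)
apply: contraT => gn0; have := und ord_max; rewrite -[negb _]/(~~ _).
rewrite (decodable_of_det hZ _ b0 gn0) // => s st.
exact: und (Ordinal (ltnW st : (s < t.+1)%N)).
Qed.

End Counting.

(** * Decoding times and the probability bound *)

Section DecodingTime.
Variables (N : network) (F : finFieldType) (m d : nat).
Variables (r : 'I_d -> node N) (Z : {set edge N * edge N}) (R : realType).

Lemma decoding_time_leP (x : coef_index N m -> F) t v :
  (decoding_time r Z R x v <= t%:R%:E)%E <->
  exists2 s, (s <= t)%N & decodable_at r Z x s v.
Proof.
split=> [le_t|[s st ds]]; last first.
  apply: ge_ereal_inf; exists (s%:R%:E); first by exists s.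
  by rewrite lee_fin ler_nat.
apply: contrapT => nd; move: le_t; apply/negP; rewrite -ltNge.
(* Times are integers, so with no decoding up to [t] the infimum is at least [t.+1], also when it is
   infinite. *)
apply: (@lt_le_trans _ _ (t.+1%:R%:E)); first by rewrite lte_fin ltr_nat.
apply/ereal_infP => _ [s ds <-]; rewrite lee_fin ler_nat ltnNge.
by apply/negP => st; apply: nd; exists s.
Qed.

Lemma network_decoding_time_gtP (x : coef_index N m -> F) t :
  (t%:R%:E < network_decoding_time r Z R x)%E <->
  exists i, forall s, (s <= t)%N -> ~~ decodable_at r Z x s (r i).
Proof.
rewrite ltNge /network_decoding_time; split=> [|[i nd]].
  move/negP; apply: contra_notP => nd; apply/bigmax_leP; split=> [|i _]; first exact: leNye.
  apply/decoding_time_leP; apply: contrapT => ni; apply: nd; exists i => s st.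
  by apply/negP => ds; apply: ni; exists s.
apply/negP => /bigmax_leP[_ /(_ i isT)/decoding_time_leP[s /nd/negP]]; exact.
Qed.

End DecodingTime.

Theorem corollary2 (R : realType) (disp : measure_display)
  (T : measurableType disp) (P : probability T R)
  (N : network) (F : finFieldType) (m d : nat) (r : 'I_d -> node N)
  (Z : {set edge N * edge N}) (X : coef_index N m -> T -> F) :
  (forall i, m%:R <= max_flow R (r i)) ->
  delay_set Z ->
  iid_uniform P [set i | drawn Z i]%classic X ->
  forall eps : R, 0 < eps < 1 ->
  exists2 T0 : nat, (0 < T0)%N &
    forall t : nat, (T0 <= t)%N ->
      let TN w := network_decoding_time r Z R (X ^~ w) in
      ((1 - eps)%:E <= P [set w | (TN w <= t%:R%:E)%E]%classic)%E /\
      (P [set w | (t%:R%:E < TN w)%E]%classic < eps%:E)%E.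
Proof.
move=> mflow hZ iidX eps /andP[eps0 _].
(* The constant of [card_undecoded] times the number of sinks: failure at time [t] has probability
   at most [K / q ^ t]. Past the bound chosen next, [K / eps < t < q ^ t]. *)
pose K := (d * (#|{: (edge N * edge N) + (edge N * 'I_m)}| * #|{: 'I_m + edge N}|))%N.
exists (Num.bound (K%:R / eps)).+1 => // t tT TN.
pose Q (a : {ffun draw_index m Z t -> F}) := [exists i, undecoded r i a].
(* Failure at time [t] depends only on the finite sample of draws up to [t]. *)
have ltTN : [set w | (t%:R%:E < TN w)%E]%classic =
    [set w | Q (sample X (@coef_of _ _ Z t) w)]%classic.
  have same w s : (s <= t)%N -> arcnc r Z (X ^~ w) s =
      arcnc r Z (extend (sample X (@coef_of _ _ Z t) w)) s.
    move=> st; apply: arcnc_ext => u s' s's ds'.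
    have [l us'] := coef_ofP (leq_trans s's st) ds'.
    by rewrite -us' extend_coef_of ffunE.
  apply/seteqP; split=> w /=.
    move=> /network_decoding_time_gtP[i nd]; apply/existsP; exists i; apply/forallP => s.
    have st : (s <= t)%N by rewrite -ltnS ltn_ord.
    by rewrite /decodable_at -(same _ _ st); exact: nd st.
  move=> /existsP[i /forallP nd]; apply/network_decoding_time_gtP; exists i => s st.
  by have := nd (Ordinal (st : (s < t.+1)%N)); rewrite /decodable_at -(same _ _ st).
have [mQ PQ] := sample_law iidX (@coef_of_inj _ _ Z t) (@coef_of_drawn _ _ Z t) Q.
have cardQ : (#|F| ^ t * #|Q| <= K * #|F| ^ #|draw_index m Z t|)%N.
  (* Union bound over the sinks. *)
  apply: (@leq_trans (\sum_i #|F| ^ t * #|[pred a | undecoded r i a]|)).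
    rewrite -big_distrr /= leq_mul2l; apply/orP; right.
    apply: (@leq_trans (\sum_(a : {ffun draw_index m Z t -> F}) \sum_i undecoded r i a)).
      rewrite -sum1_card big_mkcond; apply: leq_sum => a _.
      case: ifP => // /existsP[i ui]; rewrite (bigD1 i) //= ui; exact: leq_addr.
    rewrite exchange_big; apply: leq_sum => i _; rewrite -sum1_card [leqRHS]big_mkcond.
    by apply: leq_sum => a _; rewrite inE; case: ifP.
  rewrite /K -!mulnA -[X in (_ <= X * _)%N]card_ord -sum_nat_const; apply: leq_sum => i _.
  by rewrite mulnA; exact: card_undecoded (mflow i) hZ.
have Plt : (P [set w | (t%:R%:E < TN w)%E]%classic < eps%:E)%E.
  rewrite ltTN PQ lte_fin.
  have F1 : (1 < #|F|)%N by apply: card_finNzRing_gt1.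
  have Fgt n : (0 < (#|F| ^ n)%:R :> R) by rewrite ltr0n expn_gt0 ltnW.
  rewrite ltr_pdivrMr // -(ltr_pM2l (Fgt t)) -natrM.
  apply: (@le_lt_trans _ _ (K * #|F| ^ #|draw_index m Z t|)%:R); first by rewrite ler_nat.
  rewrite natrM mulrA ltr_pM2r // -ltr_pdivrMr //.
  have := archi_boundP (divr_ge0 (ler0n R K) (ltW eps0)); move/lt_le_trans; apply.
  rewrite ler_nat (leq_trans (leqnSn _)) // (leq_trans tT) // ltnW //.
  by apply: ltn_expl.
split=> //.
have -> : [set w | (TN w <= t%:R%:E)%E]%classic = (~` [set w | (t%:R%:E < TN w)%E])%classic.
  by apply/seteqP; split=> w /=; rewrite leNgt => /negP.
move: Plt; rewrite ltTN probability_setC // PQ => Plt.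
by rewrite -EFinB lee_fin lerB // ltW.
Qed.
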